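(* Let $G(\mathbf u;\bm\theta)=\mathcal G(\mathbf u)+A\bm\theta$ and let $D\subset\mathbb R^{n(N+1)}$ be an open convex set. Assume that $\mathcal G$ is continuously differentiable in $D$ and that there are constants $L_0,L_3>0$ with $$\|\mathcal G(\mathbf u)-\mathcal G(\mathbf v)\|\le L_0\|\mathbf u-\mathbf v\|,\qquad \|\mathcal G'(\mathbf u)-\mathcal G'(\mathbf v)\|\le L_3\|\mathbf u-\mathbf v\|,\qquad\forall\,\mathbf u,\mathbf v\in D.$$ Let $c>0$ be an upper bound on the norm of the initial error $\|\mathbf e_0\|$, and let $\alpha>0$ be such that $$\big\|\big(\mathcal G'(\mathbf x)^T\mathcal G'(\mathbf x)+\alpha H^TH\big)^{-1}\mathcal G'(\mathbf x)^T\big\|\le(2L_3c)^{-1},\qquad\forall\,\mathbf x\in D.$$ Put $b=\|A(A^TA)^{-1}A^T\|\,L_0/L_3$ and assume $b/c<1$. Assume that the observations of the state are noise-free, $\mathbf y=H\mathbf u^\dagger$. Let $(\mathbf u^{(k)},\bm\theta^{(k)})_{k\ge0}$ be the joint state-parameter Gauss-Newton iteration with this $\alpha$, and let $\mathbf e_k=\mathbf u^{(k)}-\mathbf u^\dagger$. Then $$\limsup_{k\to\infty}\|\mathbf e_k\|<\frac{b/2}{1-b/c}$$ and $$\limsup_{k\to\infty}\|\bm\theta^{(k)}-\bm\theta^\dagger\|<L_0\,\|(A^TA)^{-1}A^T\|\,\frac{b/2}{1-b/c}.$$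
   Context: Norms: $\|\cdot\|$ is the Euclidean norm for vectors (in any dimension) and the induced operator norm for matrices. Model: let $n,N,q\ge1$. For a parameter $\bm\theta=(\theta_1,\dots,\theta_q)^T\in\mathbb R^q$ the discrete dynamical model is $u_{j+1}=F_j(u_j;\bm\theta)$, $j=0,\dots,N-1$, $u_j\in\mathbb R^n$, with each $F_j$ twice continuously differentiable in $u_j$. For $\mathbf u=(u_0,\dots,u_N)\in\mathbb R^{n(N+1)}$, $G(\mathbf u;\bm\theta)\in\mathbb R^{nN}$ is the vector with block components $u_{j+1}-F_j(u_j;\bm\theta)$, $j=0,\dots,N-1$. Here $G$ is affine in the parameter, $G(\mathbf u;\bm\theta)=\mathcal G(\mathbf u)+A\bm\theta$ with a matrix $A\in\mathbb R^{nN\times q}$. The true state $\mathbf u^\dagger\in\mathbb R^{n(N+1)}$ and true parameter $\bm\theta^\dagger\in\mathbb R^q$ satisfy the model, i.e. $\mathcal G(\mathbf u^\dagger)+A\bm\theta^\dagger=0$. $\mathcal G'$ denotes the Jacobian of $\mathcal G$. Observations: at time indices $0\le k_0<\dots<k_M\le N$ one has linear observation operators $\mathcal H_{k_i}:\mathbb R^n\to\mathbb R^p$, $p\le n$; $H$ is the linear map $H\mathbf u=(\mathcal H_{k_0}u_{k_0},\dots,\mathcal H_{k_M}u_{k_M})$ on $\mathbb R^{n(N+1)}$, and noise-free observations are $\mathbf y=H\mathbf u^\dagger$. Joint state-parameter Gauss-Newton iteration with parameter $\alpha$: starting from initial guesses $\mathbf u^{(0)}\in\mathbb R^{n(N+1)}$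 and $\bm\theta^{(0)}\in\mathbb R^q$, for $k\ge0$, $$\mathbf u^{(k+1)}=\mathbf u^{(k)}-\big(\mathcal G'(\mathbf u^{(k)})^T\mathcal G'(\mathbf u^{(k)})+\alpha H^TH\big)^{-1}\Big(\mathcal G'(\mathbf u^{(k)})^T\big(\mathcal G(\mathbf u^{(k)})+A\bm\theta^{(k)}\big)+\alpha H^T(H\mathbf u^{(k)}-\mathbf y)\Big),$$ $$\bm\theta^{(k+1)}=\bm\theta^{(k)}-(A^TA)^{-1}A^T\big(\mathcal G(\mathbf u^{(k+1)})+A\bm\theta^{(k)}\big).$$
   Formalization: The formal theorem additionally assumes that the true state and all iterates u^(k) lie in D; without this the hypotheses on D say nothing about the iteration and the claim fails (e.g. D empty). The invertibility of the inverted matrices is also assumed explicitly. *)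

(* Defs.v *)
From HB Require Import structures.
From mathcomp Require Import all_boot all_order all_algebra.
From mathcomp Require Import all_classical all_reals all_analysis.

Set Implicit Arguments.
Unset Strict Implicit.
Unset Printing Implicit Defensive.

Import Order.TTheory GRing.Theory Num.Theory.
Import numFieldNormedType.Exports.

Local Open Scope classical_set_scope.
Local Open Scope ring_scope.

(* The library norm `|_| on matrices is the max norm, so the Euclidean norm
   and its induced operator norm are defined here.  In finite dimension the
   topology and differentiability do not depend on the choice of norm. *)
Definition enorm (R : realType) (m : nat) (x : 'cV[R]_m) : R :=
  Num.sqrt (\sum_i x i 0 ^+ 2).

Definition opnorm (R : realType) (m n : nat) (B : 'M[R]_(m, n)) : R :=
  sup [set enorm (B *m x) | x in [set x : 'cV[R]_n | enorm x <= 1]].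

(* The library's 'J f p is for maps between row vectors; this one is for
   column vectors and satisfies jac f x *m v = 'd f x v. *)
Definition jac (R : realType) (m n : nat) (f : 'cV[R]_n -> 'cV[R]_m)
    (x : 'cV[R]_n) : 'M[R]_(m, n) :=
  \matrix_(i, j) 'd f x (delta_mx j 0) i 0.

(* When V has finite dimension, continuity of y |-> 'd f y v for every v is
   continuity of y |-> 'd f y. Used below only on column-vector spaces. *)
Definition C1_on (R : realType) (V W : normedModType R) (f : V -> W)
    (D : set V) : Prop :=
  (forall x, D x -> differentiable f x) /\
  (forall v x, D x -> {for x, continuous (fun y => 'd f y v)}).

Definition C2 (R : realType) (V W : normedModType R) (f : V -> W) : Prop :=
  C1_on f setT /\ forall v, C1_on (fun y => 'd f y v) setT.

(* A trajectory (u_0, ..., u_N) is a column made of N.+1 blocks of height n,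
   with u_j = submxcol u j; the j-th block below is u_(j+1) - F_j(u_j; th). *)
Definition model_residual (R : realType) (n N q : nat)
    (F : 'I_N -> 'cV[R]_n -> 'cV[R]_q -> 'cV[R]_n)
    (u : 'cV[R]_(\sum_(j < N.+1) n)) (th : 'cV[R]_q) :
    'cV[R]_(\sum_(j < N) n) :=
  \mxcol_(j < N) (submxcol u (lift ord0 j)
                  - F j (submxcol u (widen_ord (leqnSn N) j)) th).

(* The matrix of u |-> (Hk_0 u_(k_0), ..., Hk_M u_(k_M)). *)
Definition obs_mx (R : realType) (n N M p : nat) (k : 'I_M.+1 -> 'I_N.+1)
    (Hk : 'I_M.+1 -> 'M[R]_(p, n)) :
    'M[R]_(\sum_(i < M.+1) p, \sum_(j < N.+1) n) :=
  \mxblock_(i < M.+1, j < N.+1) (if j == k i then Hk i else 0).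

Definition gn_mx (R : realType) (d r s : nat) (calG : 'cV[R]_d -> 'cV[R]_r)
    (H : 'M[R]_(s, d)) (alpha : R) (x : 'cV[R]_d) : 'M[R]_d :=
  (jac calG x)^T *m jac calG x + alpha *: (H^T *m H).

(* invmx B is B itself when B is singular: invertibility of the matrices
   gn_mx calG H alpha (u k) and A^T *m A is not part of this definition. *)
Definition gauss_newton (R : realType) (d r s q : nat)
    (calG : 'cV[R]_d -> 'cV[R]_r) (A : 'M[R]_(r, q)) (H : 'M[R]_(s, d))
    (y : 'cV[R]_s) (alpha : R)
    (u : nat -> 'cV[R]_d) (th : nat -> 'cV[R]_q) : Prop :=
  forall k : nat,
    u k.+1 = u k - invmx (gn_mx calG H alpha (u k)) *m
               ((jac calG (u k))^T *m (calG (u k) + A *m th k)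
                + alpha *: (H^T *m (H *m u k - y))) /\
    th k.+1 = th k - invmx (A^T *m A) *m A^T *m (calG (u k.+1) + A *m th k).

(* Main.v *)
Require Import Defs.
From HB Require Import structures.
From mathcomp Require Import all_boot all_order all_algebra.
From mathcomp Require Import all_classical all_reals all_analysis.
From mathcomp Require Import ring.
Import Order.TTheory GRing.Theory Num.Theory.
Import numFieldNormedType.Exports.
Local Open Scope classical_set_scope.
Local Open Scope ring_scope.

(** Write [e] for the state error at a step, [B] for [gn_mx] and [J] for the
    Jacobian of [calG] there, [g] for the difference of [calG] at the iterate and
    at the truth, and [P = A (A^T A)^-1 A^T] for the orthogonal projection onto the
    range of [A].

    The model is affine in the parameter, so the parameter step is an exact
    linear least-squares solve: after it, the parameter error is
    [- (A^T A)^-1 A^T g] ([parameter_error]). Since the data are exact, the next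
    state error is [B^-1 J^T] applied to [J e - g] minus [A] times the parameter
    error ([state_error]). From the second step on, these two facts give that the
    next state error is [B^-1 J^T (J e - (1 - P) g)].

    On the open set [D] the Lipschitz constant [L0] of [calG] bounds its Jacobian
    ([enorm_jac_le]), and [1 - P] does not increase the Euclidean norm
    ([enorm_orthogonal_residual_le]), so the parenthesis has norm at most
    [2 L0 |e|]. With [|B^-1 J^T| <= (2 L3 c)^-1] the state error is multiplied at
    each step by a factor at most [L0 / (L3 c)] ([state_error_contraction]). A
    nonzero projection satisfies [|P| >= 1] ([lsq_proj_ge1]), hence
    [L0 / (L3 c) <= b / c < 1].

    This estimate is global: it does not compare [|e|] with [c], which matters
    because an arbitrary initial parameter can make the state error large after
    the first step. It follows that the state error tends to 0, and with it the
    parameter error. Both upper limits are therefore 0, while both claimed bounds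
    are positive because [b > 0] and [b < c]. *)

(** * The Euclidean norm and its operator norm *)
Section Euclid.
Context {R : realType}.

Lemma enorm_ge0 {m} (x : 'cV[R]_m) : 0 <= enorm x.
Proof. exact: sqrtr_ge0. Qed.

Lemma sqr_enorm {m} (x : 'cV[R]_m) : enorm x ^+ 2 = \sum_i x i 0 ^+ 2.
Proof. by rewrite sqr_sqrtr // sumr_ge0 // => i _; rewrite sqr_ge0. Qed.

Lemma sqr_enorm_mx {m} (x : 'cV[R]_m) : enorm x ^+ 2 = (x^T *m x) 0 0.
Proof. by rewrite sqr_enorm mxE; apply: eq_bigr => i _; rewrite mxE expr2. Qed.

Lemma enorm0 {m} : enorm (0 : 'cV[R]_m) = 0.
Proof.
by apply/eqP; rewrite -sqrf_eq0 sqr_enorm big1 // => i _; rewrite mxE expr0n.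
Qed.

Lemma enorm_eq0 {m} (x : 'cV[R]_m) : enorm x = 0 -> x = 0.
Proof.
move=> /eqP; rewrite -sqrf_eq0 sqr_enorm psumr_eq0 => [/allP x0|i _]; last first.
  by rewrite sqr_ge0.
apply/colP => i; rewrite mxE.
by have := x0 i (mem_index_enum i); rewrite sqrf_eq0 => /eqP.
Qed.

Lemma enormZ {m} (a : R) (x : 'cV[R]_m) : enorm (a *: x) = `|a| * enorm x.
Proof.
apply/eqP; rewrite -(@eqrXn2 _ 2) ?mulr_ge0 ?enorm_ge0 //.
rewrite exprMn real_normK ?num_real // !sqr_enorm mulr_sumr.
by apply/eqP/eq_bigr => i _; rewrite mxE exprMn.
Qed.

Lemma enormN {m} (x : 'cV[R]_m) : enorm (- x) = enorm x.
Proof. by rewrite -scaleN1r enormZ normrN1 mul1r. Qed.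

(** Cauchy-Schwarz: with [S] the inner product of [a] and [b], the sum of the
    squares of [Y * a i - S * b i], where [Y] is the squared norm of [b], is
    nonnegative and equals [Y] times the difference of the two sides. *)
Lemma sqr_sum_mul_le (I : finType) (a b : I -> R) :
  (\sum_i a i * b i) ^+ 2 <= (\sum_i a i ^+ 2) * (\sum_i b i ^+ 2).
Proof.
set S := \sum_i _ * _; set X := \sum_i a i ^+ 2; set Y := \sum_i b i ^+ 2.
have Y0 : 0 <= Y by apply: sumr_ge0 => i _; rewrite sqr_ge0.
have : 0 <= \sum_i (Y * a i - S * b i) ^+ 2.
  by apply: sumr_ge0 => i _; rewrite sqr_ge0.
have -> : \sum_i (Y * a i - S * b i) ^+ 2 = Y * (X * Y - S ^+ 2).
  transitivity (Y ^+ 2 * X - 2 * Y * S * S + S ^+ 2 * Y); last by ring.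
  rewrite (mulr_sumr _ _ _ (Y ^+ 2)) (mulr_sumr _ _ _ (2 * Y * S)).
  rewrite (mulr_sumr _ _ _ (S ^+ 2)) -sumrB -big_split /=.
  by apply: eq_bigr => i _; ring.
move: Y0; rewrite le_eqVlt => /orP[/eqP Y0 _|Y0]; last first.
  by rewrite pmulr_rge0 // subr_ge0.
(* If [Y = 0] then [b] vanishes, and so does [S]. *)
rewrite -Y0 mulr0.
suff -> : S = 0 by rewrite expr0n.
apply: big1 => i _.
have /eqP := esym Y0; rewrite psumr_eq0 => [/allP b0|j _]; last by rewrite sqr_ge0.
by have := b0 i (mem_index_enum i); rewrite sqrf_eq0 => /eqP ->; rewrite mulr0.
Qed.

Lemma enorm_triangle {m} (x y : 'cV[R]_m) : enorm (x + y) <= enorm x + enorm y.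
Proof.
rewrite -(@ler_pXn2r _ 2) ?nnegrE ?addr_ge0 ?enorm_ge0 //.
have xy : \sum_i x i 0 * y i 0 <= enorm x * enorm y.
  apply: le_trans (ler_norm _) _.
  rewrite -(@ler_pXn2r _ 2) ?nnegrE ?mulr_ge0 ?enorm_ge0 //.
  by rewrite real_normK ?num_real // exprMn !sqr_enorm sqr_sum_mul_le.
rewrite sqrrD !sqr_enorm -mulrnAr.
have -> : \sum_i (x + y) i 0 ^+ 2 =
    \sum_i x i 0 ^+ 2 + (\sum_i x i 0 * y i 0) *+ 2 + \sum_i y i 0 ^+ 2.
  rewrite -sumrMnl -!big_split /=.
  by apply: eq_bigr => i _; rewrite mxE sqrrD.
by rewrite lerD2r lerD2l mulrnAr lerMn2r xy orbT.
Qed.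

(** The Frobenius norm dominates the operator norm. This crude bound shows that
    the supremum defining [opnorm] is finite. *)
Lemma enorm_mulmx_le_sum {m n} (B : 'M[R]_(m, n)) (x : 'cV[R]_n) :
  enorm (B *m x) <= Num.sqrt (\sum_i \sum_j B i j ^+ 2) * enorm x.
Proof.
rewrite -sqrtrM; last by do 2!(apply: sumr_ge0 => ? _); rewrite sqr_ge0.
rewrite ler_wsqrtr // mulr_suml.
by apply: ler_sum => i _; rewrite mxE sqr_sum_mul_le.
Qed.

Lemma opnorm_ubound {m n} (B : 'M[R]_(m, n)) :
  has_ubound [set enorm (B *m x) | x in [set x : 'cV[R]_n | enorm x <= 1]].
Proof.
exists (Num.sqrt (\sum_i \sum_j B i j ^+ 2)) => _ [x /= x1 <-].
apply: le_trans (enorm_mulmx_le_sum _ _) _.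
by rewrite -[leRHS]mulr1 ler_wpM2l ?sqrtr_ge0.
Qed.

Lemma opnorm_ge0 {m n} (B : 'M[R]_(m, n)) : 0 <= opnorm B.
Proof.
apply: (ub_le_sup (opnorm_ubound B)); exists 0; last by rewrite mulmx0 enorm0.
by rewrite /= enorm0.
Qed.

Lemma enorm_mulmx_le {m n} (B : 'M[R]_(m, n)) (x : 'cV[R]_n) :
  enorm (B *m x) <= opnorm B * enorm x.
Proof.
have [x0|x_gt0] := leP (enorm x) 0.
  have /enorm_eq0 -> : enorm x = 0 by apply/eqP; rewrite eq_le x0 enorm_ge0.
  by rewrite mulmx0 !enorm0 mulr0.
rewrite -ler_pdivrMr //.
apply: (ub_le_sup (opnorm_ubound B)); exists ((enorm x)^-1 *: x).
  by rewrite /= enormZ ger0_norm ?invr_ge0 ?enorm_ge0 // mulVf // gt_eqF.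
by rewrite -scalemxAr enormZ ger0_norm ?invr_ge0 ?enorm_ge0 // mulrC.
Qed.

Lemma opnorm_gt0 {m n} (B : 'M[R]_(m, n)) (x : 'cV[R]_n) :
  B *m x != 0 -> 0 < opnorm B.
Proof.
move=> Bx; rewrite lt_neqAle opnorm_ge0 andbT eq_sym; apply: contra_neq Bx => B0.
apply/enorm_eq0/eqP; rewrite eq_le enorm_ge0 andbT.
by rewrite (le_trans (enorm_mulmx_le _ _)) // B0 mul0r.
Qed.

Lemma opnorm_ge1_fixpoint {m} (P : 'M[R]_m) (x : 'cV[R]_m) :
  x != 0 -> P *m x = x -> 1 <= opnorm P.
Proof.
move=> x0 Px; have x_gt0 : 0 < enorm x.
  by rewrite lt_neqAle enorm_ge0 andbT eq_sym; apply: contra_neq x0; exact: enorm_eq0.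
by rewrite -(ler_pM2r x_gt0) mul1r -{1}Px enorm_mulmx_le.
Qed.

(** Pythagoras: when [P] is an orthogonal projection, the square of the left
    side is that of [enorm x] minus that of [enorm (P *m x)]. *)
Lemma enorm_orthogonal_residual_le {m} (P : 'M[R]_m) (x : 'cV[R]_m) :
  P^T = P -> P *m P = P -> enorm (x - P *m x) <= enorm x.
Proof.
move=> PT PP; rewrite -(@ler_pXn2r _ 2) ?nnegrE ?enorm_ge0 //.
suff -> : enorm (x - P *m x) ^+ 2 = enorm x ^+ 2 - enorm (P *m x) ^+ 2.
  by rewrite gerBl sqr_ge0.
rewrite !sqr_enorm_mx [(x - _)^T]linearB /= trmx_mul PT mulmxBl !mulmxBr.
rewrite -!mulmxA (mulmxA P P x) PP subrr subr0.
by rewrite [LHS]mxE [X in _ + X]mxE.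
Qed.

Lemma enorm_continuous {m} : continuous (@enorm R m).
Proof.
have sum_cont : continuous (fun x : 'cV[R]_m => \sum_i x i 0 ^+ 2).
  apply: (continuous_big add_continuous) => i _ x.
  have coordx : (fun y : 'cV[R]_m => y i 0) @ x --> x i 0 by exact: coord_continuous.
  exact: (cvgM coordx coordx).
by move=> x; apply: continuous_comp (sum_cont x) _; exact: sqrt_continuous.
Qed.

Lemma closed_enorm_le {m} (a : R) : closed [set x : 'cV[R]_m | enorm x <= a].
Proof.
by apply: preimage_closed (@closed_le R a) => x _; exact: enorm_continuous.
Qed.

Lemma jac_mulmx {m n} (f : 'cV[R]_n -> 'cV[R]_m) (x v : 'cV[R]_n) :
  jac f x *m v = 'd f x v.
Proof.
rewrite {2}[v]matrix_sum_delta linear_sum /=.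
apply/colP => i; rewrite mxE summxE; apply: eq_bigr => j _.
by rewrite big_ord1 linearZ !mxE mulrC.
Qed.

(** A Lipschitz constant on an open set bounds the derivative there: the
    directional derivative is a limit of difference quotients that stay in the
    closed ball of radius [L * enorm v]. *)
Lemma enorm_jac_le {m n} (f : 'cV[R]_n -> 'cV[R]_m) (D : set 'cV[R]_n) (L : R)
    (x v : 'cV[R]_n) :
    open D -> D x -> differentiable f x ->
    (forall u w, D u -> D w -> enorm (f u - f w) <= L * enorm (u - w)) ->
  enorm (jac f x *m v) <= L * enorm v.
Proof.
move=> oD Dx df f_lip; rewrite jac_mulmx -deriveE //.
have fv : derivable f x v by exact: diff_derivable.
apply: (closed_cvg (fun w => enorm w <= L * enorm v)) fv.
  exact: closed_enorm_le.
have Dnear : \forall h \near 0^', D (h *: v + x).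
  apply: cvg_within.
  have : (fun h : R => h *: v + x) @ 0 --> x.
    rewrite -[X in _ --> X]add0r -[X in X + x](scale0r v).
    apply: cvgD; last exact: cvg_cst.
    by apply: cvgZr_tmp; exact: cvg_id.
  by apply; exact: open_nbhs_nbhs.
near=> h.
have h0 : h != 0 by near: h; exact: nbhs_dnbhs_neq.
rewrite /= enormZ normfV ler_pdivrMl ?normr_gt0 //.
apply: le_trans (f_lip _ _ _ Dx) _; first by near: h.
by rewrite addrK enormZ mulrCA.
Unshelve. all: by end_near. Qed.

End Euclid.

(** * The least-squares inverse of a full-rank matrix *)
Section LeastSquares.
Context {R : realType} {r q : nat}.
Implicit Type A : 'M[R]_(r, q).

(** The Moore-Penrose inverse of a matrix of full column rank; [A *m lsq_mx A]
    is then the orthogonal projection onto the range of [A]. *)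
Definition lsq_mx A := invmx (A^T *m A) *m A^T.

Lemma lsq_mxK A : A^T *m A \in unitmx -> lsq_mx A *m A = 1%:M.
Proof. by move=> Au; rewrite -mulmxA mulVmx. Qed.

Lemma lsq_proj_sym A : (A *m lsq_mx A)^T = A *m lsq_mx A.
Proof. by rewrite !trmx_mul trmx_inv trmx_mul !trmxK mulmxA. Qed.

Lemma lsq_proj_idem A : A^T *m A \in unitmx ->
  A *m lsq_mx A *m (A *m lsq_mx A) = A *m lsq_mx A.
Proof. by move=> Au; rewrite -mulmxA (mulmxA _ A) lsq_mxK // mul1mx. Qed.

(** The least-squares inverse sends [A *m v] back to [v], so
    it is nonzero as soon as there is a nonzero [v]. *)
Lemma lsq_mx_gt0 A : (0 < q)%N -> A^T *m A \in unitmx ->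
  0 < opnorm (lsq_mx A).
Proof.
move=> q0 Au; apply: (@opnorm_gt0 _ _ _ _ (A *m const_mx 1)).
rewrite mulmxA lsq_mxK // mul1mx.
by apply/eqP => /colP /(_ (Ordinal q0)); rewrite !mxE; apply/eqP/oner_neq0.
Qed.

(** The projection fixes the range of [A], which is nonzero because [A] is
    injective on a nonzero space. *)
Lemma lsq_proj_ge1 A : (0 < q)%N -> A^T *m A \in unitmx ->
  1 <= opnorm (A *m lsq_mx A).
Proof.
move=> q0 Au; apply: (@opnorm_ge1_fixpoint _ _ _ (A *m const_mx 1)); last first.
  by rewrite -mulmxA (mulmxA _ A) lsq_mxK // mul1mx.
apply: contraTneq isT => /(congr1 (mulmx (lsq_mx A))) /colP /(_ (Ordinal q0)).
rewrite mulmxA lsq_mxK // mul1mx mulmx0 !mxE => /eqP.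
by rewrite oner_eq0.
Qed.

End LeastSquares.

(** * Error recursions of the joint Gauss-Newton iteration *)
Section GaussNewton.
Context {R : realType} {d r s q : nat}.
Context {calG : 'cV[R]_d -> 'cV[R]_r} {A : 'M[R]_(r, q)} {H : 'M[R]_(s, d)}.
Context {alpha : R} {u : nat -> 'cV[R]_d} {th : nat -> 'cV[R]_q}.
Context {udag : 'cV[R]_d} {thdag : 'cV[R]_q}.
Hypothesis truth : calG udag + A *m thdag = 0.
Hypothesis iteration : gauss_newton calG A H (H *m udag) alpha u th.

Lemma residual_error (x : 'cV[R]_d) (t : 'cV[R]_q) :
  calG x + A *m t = calG x - calG udag + A *m (t - thdag).
Proof.
by rewrite mulmxBr -[LHS]subr0 -truth opprD addrACA.
Qed.

(** The parameter update solves a linear least-squares problem exactly, so the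
    old parameter error cancels and the new one depends on the new state only. *)
Lemma parameter_error m : A^T *m A \in unitmx ->
  th m.+1 - thdag = - (lsq_mx A *m (calG (u m.+1) - calG udag)).
Proof.
move=> Au; rewrite (iteration m).2 residual_error mulmxDr.
rewrite mulmxA -/(lsq_mx A) lsq_mxK // mul1mx.
by rewrite opprD opprB addrCA (addrC (th m)) subrK addrK.
Qed.

(** With exact data the observation misfit is [H] applied to the state error;
    it cancels against the [alpha *: (H^T *m H)] part of [gn_mx]. What remains is
    the linearization error of [calG] and the parameter error. *)
Lemma state_error m : gn_mx calG H alpha (u m) \in unitmx ->
  u m.+1 - udag = invmx (gn_mx calG H alpha (u m)) *m (jac calG (u m))^T *m
    (jac calG (u m) *m (u m - udag) - (calG (u m) - calG udag)
       - A *m (th m - thdag)).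
Proof.
set e := u m - udag; set J := jac calG (u m) => Bu.
rewrite (iteration m).1 residual_error -/e -/J.
rewrite -mulmxBr addrAC -/e -[X in X - _ = _](mulKmx Bu) -mulmxBr -mulmxA.
congr (_ *m _); rewrite /gn_mx -/J mulmxDl -scalemxAl -!mulmxA.
by rewrite opprD addrACA subrr addr0 -mulmxBr -[in RHS]addrA -opprD.
Qed.

(** Substituting [parameter_error] into [state_error] turns the bracket into
    [J *m e - (1 - P) *m g], with [e] the state error, [J] the Jacobian,
    [g = calG (u m.+1) - calG udag] and [P] the orthogonal projection onto the
    range of [A]. Both terms are at most [L0 * enorm e], so no smallness of [e]
    enters the estimate. The index starts at [m.+1] because the initial
    parameter is arbitrary. *)
Lemma state_error_contraction {D : set 'cV[R]_d} {L0 kappa : R} {m : nat} :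
    A^T *m A \in unitmx -> open D -> D (u m.+1) -> D udag ->
    differentiable calG (u m.+1) ->
    gn_mx calG H alpha (u m.+1) \in unitmx ->
    0 <= L0 ->
    (forall x y, D x -> D y -> enorm (calG x - calG y) <= L0 * enorm (x - y)) ->
    opnorm (invmx (gn_mx calG H alpha (u m.+1)) *m (jac calG (u m.+1))^T)
      <= kappa ->
  enorm (u m.+2 - udag) <= 2 * kappa * L0 * enorm (u m.+1 - udag).
Proof.
move=> Au oD Dum Dudag dG Bu L0_ge0 G_lip K_le.
rewrite state_error // parameter_error // mulmxN opprK mulmxA.
set e := u m.+1 - udag; set g := calG _ - calG _; set J := jac _ _.
have kappa_ge0 : 0 <= kappa by apply: le_trans K_le; exact: opnorm_ge0.
apply: le_trans (enorm_mulmx_le _ _) _.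
rewrite (mulrC 2) -!mulrA; apply: ler_pM K_le _; rewrite ?opnorm_ge0 ?enorm_ge0 //.
rewrite -addrA; apply: le_trans (enorm_triangle _ _) _.
rewrite mulrDl mul1r lerD //; first exact: enorm_jac_le oD Dum dG G_lip.
rewrite addrC -opprB enormN; apply: le_trans _ (G_lip _ _ Dum Dudag).
apply: enorm_orthogonal_residual_le; [exact: lsq_proj_sym|exact: lsq_proj_idem].
Qed.

End GaussNewton.

(** * Conclusion *)

(** The bound starts at index 1: the first step of the iteration need not
    decrease the state error. *)
Lemma contraction_cvg0 {R : realType} (a : nat -> R) (rho : R) :
    (forall m, 0 <= a m) -> 0 <= rho < 1 ->
    (forall m, a m.+2 <= rho * a m.+1) ->
  a @ \oo --> 0.
Proof.
move=> a_ge0 /andP[rho_ge0 rho_lt1] a_le.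
have a_geo m : a m.+1 <= geometric (a 1%N) rho m.
  elim: m => [|m IHm]; first by rewrite /geometric /= expr0 mulr1.
  apply: le_trans (a_le m) _.
  by rewrite /geometric /= exprS mulrCA ler_wpM2l.
rewrite -cvg_shiftS.
apply: (@squeeze_cvgr _ _ _ _ (cst 0) (geometric (a 1%N) rho)).
- by apply: nearW => m; rewrite a_ge0 a_geo.
- exact: cvg_cst.
- by apply: cvg_geometric; rewrite ger0_norm.
Qed.

Lemma limn_esup_lt_of_cvg0 {R : realType} (a : nat -> R) (B : R) :
  a @ \oo --> 0 -> 0 < B -> (limn_esup (fun m => (a m)%:E) < B%:E)%E.
Proof.
move=> a0 B0; have aE : (fun m => (a m)%:E) @ \oo --> 0%:E.
  by apply: cvg_EFin a0; exact: nearW.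
by rewrite (cvg_limn_einf_sup aE).2 lte_fin.
Qed.

Theorem theorem3 (R : realType) (n N q p M : nat)
    (n_gt0 : (0 < n)%N) (N_gt0 : (0 < N)%N) (q_gt0 : (0 < q)%N)
    (p_le_n : (p <= n)%N)
    (* the model, affine in the parameter *)
    (F : 'I_N -> 'cV[R]_n -> 'cV[R]_q -> 'cV[R]_n)
    (F_C2 : forall j th, C2 (fun x => F j x th))
    (calG : 'cV[R]_(\sum_(j < N.+1) n) -> 'cV[R]_(\sum_(j < N) n))
    (A : 'M[R]_(\sum_(j < N) n, q))
    (G_affine : forall u th, model_residual F u th = calG u + A *m th)
    (AtA_unit : A^T *m A \in unitmx)
    (* the truth and the noise-free observations *)
    (udag : 'cV[R]_(\sum_(j < N.+1) n)) (thdag : 'cV[R]_q)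
    (truth : calG udag + A *m thdag = 0)
    (k : 'I_M.+1 -> 'I_N.+1) (k_incr : {homo k : i j / (i < j)%N})
    (Hk : 'I_M.+1 -> 'M[R]_(p, n))
    (y : 'cV[R]_(\sum_(i < M.+1) p)) (y_exact : y = obs_mx k Hk *m udag)
    (* regularity on D *)
    (D : set 'cV[R]_(\sum_(j < N.+1) n))
    (D_open : open D) (D_convex : convex_set D)
    (G_C1 : C1_on calG D)
    (L0 L3 : R) (L0_gt0 : 0 < L0) (L3_gt0 : 0 < L3)
    (G_lip : forall u v, D u -> D v ->
       enorm (calG u - calG v) <= L0 * enorm (u - v))
    (G'_lip : forall u v, D u -> D v ->
       opnorm (jac calG u - jac calG v) <= L3 * enorm (u - v))
    (c alpha : R) (c_gt0 : 0 < c) (alpha_gt0 : 0 < alpha)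
    (gn_unit : forall x, D x -> gn_mx calG (obs_mx k Hk) alpha x \in unitmx)
    (gn_bound : forall x, D x ->
       opnorm (invmx (gn_mx calG (obs_mx k Hk) alpha x) *m (jac calG x)^T)
         <= (2 * L3 * c)^-1)
    (b : R) (b_def : b = opnorm (A *m invmx (A^T *m A) *m A^T) * L0 / L3)
    (b_lt_c : b / c < 1)
    (* the iteration; it and the truth live in D *)
    (u : nat -> 'cV[R]_(\sum_(j < N.+1) n)) (th : nat -> 'cV[R]_q)
    (iteration : gauss_newton calG A (obs_mx k Hk) y alpha u th)
    (udag_D : D udag) (u_D : forall m, D (u m))
    (e0_le_c : enorm (u 0%N - udag) <= c) :
  (limn_esup (fun m => (enorm (u m - udag))%:E)
     < ((b / 2) / (1 - b / c))%:E)%E /\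
  (limn_esup (fun m => (enorm (th m - thdag))%:E)
     < (L0 * opnorm (invmx (A^T *m A) *m A^T)
          * ((b / 2) / (1 - b / c)))%:E)%E.
Proof.
set H := obs_mx k Hk in y_exact gn_unit gn_bound iteration.
rewrite -mulmxA -/(lsq_mx A) in b_def *.
have L3c : 0 < L3 * c by rewrite mulr_gt0.
have b_gt0 : 0 < b.
  rewrite b_def !divr_gt0 // mulr_gt0 //.
  by rewrite (lt_le_trans ltr01) ?lsq_proj_ge1.
have bound_gt0 : 0 < b / 2 / (1 - b / c) by rewrite !divr_gt0 // subr_gt0.
have rho_ge0 : 0 <= L0 / (L3 * c) by rewrite divr_ge0 ?ltW.
(* [b / c] is [|P|] times this rate, and [|P| >= 1]. *)
have rho_lt1 : L0 / (L3 * c) < 1.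
  apply: le_lt_trans b_lt_c; rewrite b_def invfM -!mulrA.
  rewrite ler_peMl ?lsq_proj_ge1 //.
  by rewrite -invfM.
rewrite y_exact in iteration.
have e_cvg0 : (fun m => enorm (u m - udag)) @ \oo --> 0.
  apply: (@contraction_cvg0 _ _ (L0 / (L3 * c))) => [m||m].
  - exact: enorm_ge0.
  - by rewrite rho_ge0.
  - have -> : L0 / (L3 * c) = 2 * (2 * L3 * c)^-1 * L0.
      by rewrite -(mulrA 2 L3) [(2 * _)^-1]invfM mulVKf ?pnatr_eq0 // mulrC.
    exact: (state_error_contraction truth iteration AtA_unit D_open (u_D _)
      udag_D (G_C1.1 _ (u_D _)) (gn_unit _ (u_D _)) (ltW L0_gt0) G_lip
      (gn_bound _ (u_D _))).
split; first exact: limn_esup_lt_of_cvg0.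
apply: limn_esup_lt_of_cvg0; last first.
  by rewrite mulr_gt0 // mulr_gt0 ?lsq_mx_gt0.
rewrite -cvg_shiftS.
apply: (@squeeze_cvgr _ _ _ _ (cst 0)
  (fun m => opnorm (lsq_mx A) * L0 * enorm (u m.+1 - udag))).
- apply: nearW => m; rewrite /= enorm_ge0 (parameter_error truth iteration) // enormN.
  rewrite -mulrA (le_trans (enorm_mulmx_le _ _)) // ler_wpM2l ?opnorm_ge0 //.
  exact: G_lip.
- exact: cvg_cst.
- rewrite -[X in _ --> X](mulr0 (opnorm (lsq_mx A) * L0)).
  by apply: cvgMr; rewrite (cvg_shiftS (fun m => enorm (u m - udag))).
Qed.
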